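(* Every finite admissible-closed argumentation framework is naive-recasting.
   Context: All objects are finite. An argumentation framework is a pair $F=\langle \mathcal{A},\mathcal{R}\rangle$ where $\mathcal{A}$ is a finite set (of arguments) and $\mathcal{R}\subseteq\mathcal{A}\times\mathcal{A}$ (attacks; self-attacks are allowed). For $S\subseteq\mathcal{A}$: $S^+=\{x\in\mathcal{A}\mid \exists y\in S,\ (y,x)\in\mathcal{R}\}$ and $S^-=\{x\in\mathcal{A}\mid \exists y\in S,\ (x,y)\in\mathcal{R}\}$. A set $S\subseteq\mathcal{A}$ is conflict-free if $S\cap S^+=\emptyset$; naive sets are the inclusion-wise maximal conflict-free sets, forming the family $\mathrm{NAIV}(F)$. $S$ is admissible if it is conflict-free and self-defending, i.e. $S^-\subseteq S^+$. Preferred extensions are the inclusion-wise maximal admissible sets, forming the family $\mathrm{PREF}(F)$. $F$ is admissible-closed if its admissible sets are closed under intersection (the intersection of any two admissible sets is admissible). $F$ is naive-recasting if there exists an argumentation framework $F'=\langle\mathcal{A}',\mathcal{R}'\rangle$ such that $\mathrm{PREF}(F)=\mathrm{NAIV}(F')$. *)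

(* Defs.v *)
From mathcomp Require Import all_boot finmap.

Set Implicit Arguments.
Unset Strict Implicit.
Unset Printing Implicit Defensive.

Local Open Scope fset_scope.

(* Arguments are drawn from an ambient universe [U], so that the extensions   *)
(* of two frameworks with different argument sets live in the common type     *)
(* [{fset U}] and families of extensions can be compared by plain equality.   *)
Record framework (U : choiceType) := Framework {
  args : {fset U};
  attacks : {fset U * U};
  attacks_sub : attacks `<=` args `*` args
}.

Section Semantics.
Variables (U : choiceType) (F : framework U).
Implicit Types S T : {fset U}.

(* [S^+] and [S^-] *)
Definition attacked_by S : {fset U} :=
  [fset x in args F | [exists y : S, (val y, x) \in attacks F]].

Definition attackers_of S : {fset U} :=
  [fset x in args F | [exists y : S, (x, val y) \in attacks F]].

Definition conflict_free_sets : {fset {fset U}} :=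
  [fset S in fpowerset (args F) | S `&` attacked_by S == fset0].

Definition admissible_sets : {fset {fset U}} :=
  [fset S in conflict_free_sets | attackers_of S `<=` attacked_by S].

Definition maximal_sets (P : {fset {fset U}}) : {fset {fset U}} :=
  [fset S in P | [forall T : P, ~~ (S `<` val T)]].

Definition naive_sets : {fset {fset U}} := maximal_sets conflict_free_sets.

Definition preferred_extensions : {fset {fset U}} :=
  maximal_sets admissible_sets.

Definition admissible_closed : Prop :=
  forall S T, S \in admissible_sets -> T \in admissible_sets ->
    S `&` T \in admissible_sets.

End Semantics.

Definition naive_recasting (U : choiceType) (F : framework U) : Prop :=
  exists F' : framework U, preferred_extensions F = naive_sets F'.

(* Main.v *)
(* By intersection-closure every accepted argument [a] lies in a least        *)
(* admissible set [H a].  If two arguments [a], [b] lie in a common           *)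
(* admissible set [S], then [H a] and [H b] are both included in [S], hence   *)
(* do not attack each other.  So if the members of [T] are pairwise jointly   *)
(* accepted, the union of the [H a], [a] in [T], is conflict-free, and it     *)
(* defends itself as a union of self-defending sets.  Hence, when attacks     *)
(* are drawn exactly between the arguments that are not jointly accepted,     *)
(* the conflict-free sets are the subsets of admissible sets, and the         *)
(* maximal ones are the preferred extensions.                                 *)
Require Import Defs.
From mathcomp Require Import all_boot finmap.

Set Implicit Arguments.
Unset Strict Implicit.
Unset Printing Implicit Defensive.

Local Open Scope fset_scope.

(** The witness is [incompatibility_framework F], whose conflict-free sets are the sets of pairwise
    jointly accepted arguments ([incompatibility_conflict_freeP]). Each admissible set of [F] is one
    of them, and each of them lies in an admissible set, the union of the hulls of its members:
    [accepted_hull_admissible], where closure is used, handles a single hull and [admissible_bigcup]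
    glues them. By [eq_maximal_sets], the two families then have the same maximal members. *)

Lemma maximal_setsP (U : choiceType) (P : {fset {fset U}}) (S : {fset U}) :
  reflect (S \in P /\ forall T, T \in P -> S `<=` T -> S = T)
          (S \in maximal_sets P).
Proof.
rewrite !inE /=; apply: (iffP andP) => -[SP maxS]; split=> //.
- move=> T TP sST; apply/eqP; move/forallP/(_ [` TP]): maxS => /=.
  by rewrite fproperEneq sST andbT negbK.
- apply/forallP=> T; apply/negP; rewrite fproperEneq => /andP[neST sST].
  by rewrite (maxS _ (valP T) sST) eqxx in neST.
Qed.

(** Cofinality: a maximal member of [Q] equals the member of [P] above it, and a member of [Q] above
    a maximal member of [P] is squeezed between it and a member of [P]. *)
Lemma eq_maximal_sets (U : choiceType) (P Q : {fset {fset U}}) :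
  P `<=` Q -> (forall T, T \in Q -> exists2 S, S \in P & T `<=` S) ->
  maximal_sets P = maximal_sets Q.
Proof.
move=> sPQ Qle; apply/fsetP=> S.
apply/maximal_setsP/maximal_setsP => -[SX maxS].
- split=> [|T /Qle[E EP sTE] sST]; first exact: (fsubsetP sPQ).
  by apply/eqP; rewrite eqEfsubset sST (maxS E EP (fsubset_trans sST sTE)).
- have [E EP sSE] := Qle S SX.
  split=> [|T /(fsubsetP sPQ)]; last exact: maxS.
  by rewrite (maxS E (fsubsetP sPQ _ EP) sSE).
Qed.

(** Descent on cardinality: if some member [T] containing [a] does not include [S], then [S] is
    replaced by the strictly smaller [S] ∩ [T]. *)
Lemma least_member (U : choiceType) (P : {fset {fset U}}) (a : U) S :
    (forall S T, S \in P -> T \in P -> S `&` T \in P) ->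
    S \in P -> a \in S ->
  exists E, [/\ E \in P, a \in E & forall T, T \in P -> a \in T -> E `<=` T].
Proof.
move=> PI; have [n] := ubnP #|` S|; elim: n S => // n IHn S ltSn SP aS.
have [/existsP[T /andP[aT nST]] | noT] :=
  boolP [exists T : P, (a \in val T) && ~~ (S `<=` val T)].
- apply: (IHn (S `&` val T)); [|exact: PI (valP T)|by rewrite inE aS].
  rewrite ltnS in ltSn; apply: leq_trans ltSn; apply: fproper_ltn_card.
  by rewrite fproperEneq fsubsetIl andbT; apply: contra nST => /eqP/fsetIidPl.
- exists S; split=> // T TP aT; apply: contraNT noT => nST.
  by apply/existsP; exists [` TP]; rewrite /= aT.
Qed.

Section Semantics.
Variables (U : choiceType) (F : framework U).
Implicit Types S T : {fset U}.

Lemma attacks_args x y :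
  (x, y) \in attacks F -> (x \in args F) && (y \in args F).
Proof. by move/(fsubsetP (attacks_sub F)); rewrite in_fsetM. Qed.

Lemma attacked_byP S x :
  reflect (exists2 y, y \in S & (y, x) \in attacks F) (x \in attacked_by F S).
Proof.
rewrite !inE /=; apply: (iffP andP) => [[_ /existsP[y yx]] | [y yS yx]].
  by exists (val y); first exact: valP.
split; first by case/andP: (attacks_args yx).
by apply/existsP; exists [` yS].
Qed.

Lemma attackers_ofP S x :
  reflect (exists2 y, y \in S & (x, y) \in attacks F) (x \in attackers_of F S).
Proof.
rewrite !inE /=; apply: (iffP andP) => [[_ /existsP[y xy]] | [y yS xy]].
  by exists (val y); first exact: valP.
split; first by case/andP: (attacks_args xy).
by apply/existsP; exists [` yS].
Qed.

Lemma conflict_freeP S :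
  reflect (S `<=` args F /\ {in S &, forall x y, (x, y) \notin attacks F})
          (S \in conflict_free_sets F).
Proof.
rewrite !inE /= fpowersetE; apply: (iffP andP) => -[sSA cfS]; split=> //.
- move=> x y xS yS; apply/negP=> xy; have: y \in S `&` attacked_by F S.
    by rewrite inE yS; apply/attacked_byP; exists x.
  by rewrite (eqP cfS) inE.
- apply/eqP/fsetP=> y; rewrite in_fset0 in_fsetI.
  apply/negP=> /andP[yS /attacked_byP[x xS xy]].
  by have := cfS x y xS yS; rewrite xy.
Qed.

Lemma admissibleP S :
  reflect (S \in conflict_free_sets F /\
           forall x y, y \in S -> (x, y) \in attacks F ->
             exists2 z, z \in S & (z, x) \in attacks F)
          (S \in admissible_sets F).
Proof.
have -> : (S \in admissible_sets F) =
  (S \in conflict_free_sets F) && (attackers_of F S `<=` attacked_by F S).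
  by rewrite [LHS]in_fset [LHS]inE.
apply: (iffP andP) => -[cfS defS].
- split=> // x y yS xy; apply/attacked_byP/(fsubsetP defS).
  by apply/attackers_ofP; exists y.
- split=> //; apply/fsubsetP=> x /attackers_ofP[y yS xy].
  exact/attacked_byP/(defS x y).
Qed.

Lemma admissible_sub_args S : S \in admissible_sets F -> S `<=` args F.
Proof. by case/admissibleP=> /conflict_freeP[]. Qed.

(** An attack involves only two arguments, hence at most two of the sets [H a], so pairwise
    compatibility excludes conflicts in the whole union. *)
Lemma admissible_bigcup (I : choiceType) (T : {fset I}) (H : I -> {fset U}) :
    (forall a, a \in T -> H a \in admissible_sets F) ->
    {in T &, forall a b, exists2 S, S \in admissible_sets F
                                  & (H a `<=` S) && (H b `<=` S)} ->
  \bigcup_(a <- T) H a \in admissible_sets F.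
Proof.
move=> admH compatH; apply/admissibleP; split.
- apply/conflict_freeP; split.
    by apply/bigfcupsP=> a aT _; apply/admissible_sub_args/admH.
  move=> x y /bigfcupP[a /andP[aT _] xHa] /bigfcupP[b /andP[bT _] yHb].
  have [S /admissibleP[/conflict_freeP[_ cfS] _] /andP[saS sbS]] :=
    compatH a b aT bT.
  by apply: cfS; [apply: (fsubsetP saS) | apply: (fsubsetP sbS)].
- move=> x y /bigfcupP[a /andP[aT _] yHa] xy.
  have /admissibleP[_ defHa] := admH a aT.
  have [z zHa zx] := defHa x y yHa xy.
  by exists z => //; apply/bigfcupP; exists a; rewrite ?aT.
Qed.

Definition jointly_accepted (a b : U) : bool :=
  [exists S : admissible_sets F, (a \in val S) && (b \in val S)].

Lemma jointly_acceptedP a b :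
  reflect (exists2 S, S \in admissible_sets F & (a \in S) && (b \in S))
          (jointly_accepted a b).
Proof.
apply: (iffP existsP) => [[S abS] | [S admS abS]].
  by exists (val S); first exact: valP.
by exists [` admS].
Qed.

(** Bounding by [args F] keeps this intersection finite; it is all of [args F] when no admissible
    set contains [a]. *)
Definition accepted_hull (a : U) : {fset U} :=
  [fset x in args F | [forall S : admissible_sets F,
                         (a \in val S) ==> (x \in val S)]].

Lemma accepted_hull_sub a S :
  S \in admissible_sets F -> a \in S -> accepted_hull a `<=` S.
Proof.
move=> admS aS; apply/fsubsetP=> x; rewrite !inE /= => /andP[_].
by move/forallP/(_ [` admS])/implyP/(_ aS).
Qed.

Lemma mem_accepted_hull a : a \in args F -> a \in accepted_hull a.
Proof. by move=> aA; rewrite !inE /= aA; apply/forallP=> S; apply/implyP. Qed.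

Lemma accepted_hull_admissible a : admissible_closed F ->
  jointly_accepted a a -> accepted_hull a \in admissible_sets F.
Proof.
move=> clF /jointly_acceptedP[S admS /andP[aS _]].
have [E [admE aE leastE]] := least_member clF admS aS.
suff -> : accepted_hull a = E by [].
apply/eqP; rewrite eqEfsubset accepted_hull_sub //=; apply/fsubsetP=> x xE.
rewrite !inE /= (fsubsetP (admissible_sub_args admE)) //=.
apply/forallP=> T; apply/implyP=> aT.
exact: (fsubsetP (leastE _ (valP T) aT)).
Qed.

(** The diagonal matters: an argument in no admissible set attacks itself, so no conflict-free set
    contains it. *)
Definition incompatibility_attacks : {fset U * U} :=
  [fset p in args F `*` args F | ~~ jointly_accepted p.1 p.2].

Lemma incompatibility_attacks_sub :
  incompatibility_attacks `<=` args F `*` args F.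
Proof. exact: fset_sub. Qed.

Definition incompatibility_framework : framework U :=
  Framework incompatibility_attacks_sub.

End Semantics.

Lemma incompatibility_conflict_freeP (U : choiceType) (F : framework U) T :
  reflect (T `<=` args F /\ {in T &, forall a b, jointly_accepted F a b})
          (T \in conflict_free_sets (incompatibility_framework F)).
Proof.
apply: (iffP (conflict_freeP _ _)) => -[/= sTA cfT]; split=> // a b aT bT.
- by have := cfT a b aT bT; rewrite !inE /= !(fsubsetP sTA) //= negbK.
- by rewrite !inE /= cfT ?andbF.
Qed.

Theorem theorem4p1 (U : choiceType) (F : framework U)
  (F_closed : admissible_closed F) : naive_recasting F.
Proof.
exists (incompatibility_framework F); apply: eq_maximal_sets.
- apply/fsubsetP=> S admS; apply/incompatibility_conflict_freeP.
  split=> [|a b aS bS]; first exact: admissible_sub_args.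
  by apply/jointly_acceptedP; exists S; rewrite ?aS.
- move=> T /incompatibility_conflict_freeP[sTA jaT].
  exists (\bigcup_(a <- T) accepted_hull F a).
    apply: admissible_bigcup => [a aT | a b aT bT].
      (* The pair [a], [a] provides an admissible set containing [a]. *)
      exact: accepted_hull_admissible (jaT a a aT aT).
    have /jointly_acceptedP[S admS /andP[aS bS]] := jaT a b aT bT.
    by exists S; rewrite ?accepted_hull_sub.
  apply/fsubsetP=> a aT; apply/bigfcupP; exists a; rewrite ?aT //.
  exact/mem_accepted_hull/(fsubsetP sTA).
Qed.
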